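(* Let $d\ge1$ and $\beta>0$. There exist constants $0<c_0<C_0$, $h_0>0$ and $A>0$ such that for every sample size $n$ there are two probability densities $f_1,f_2$ on $\mathbb{R}^d$, each with compact support and a unique global mode (denote the modes by $x_1$ and $x_2$), each satisfying, with $x_0$ its mode, $$f(x_0)-C_0\|x-x_0\|^\beta \le f(x)\le f(x_0)-c_0\|x-x_0\|^\beta \quad\text{whenever } \|x-x_0\|\le h_0,$$ $$f(x)\le f(x_0)-c_0h_0^\beta \quad\text{whenever } \|x-x_0\|\ge h_0,$$ whose modes satisfy $\|x_1-x_2\|\ge n^{-1/(d+2\beta)}/A$, and which cannot be distinguished based on an i.i.d. sample of size $n$ with probability of error smaller than $1/5$: for every test $\psi$ that is a measurable function of $X_1,\dots,X_n$ with values in $\{1,2\}$, $\max_{j\in\{1,2\}} P_{f_j}^{\otimes n}(\psi\ne j)\ge 1/5$.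
   Context: $\|x\|=\max_i|x_i|$ denotes the sup-norm on $\mathbb{R}^d$. $P_{f}^{\otimes n}$ denotes the law of an i.i.d. sample $X_1,\dots,X_n$ from density $f$. *)

(* Defs.v *)
From HB Require Import structures.
From mathcomp Require Import all_boot all_order all_algebra.
From mathcomp Require Import all_classical all_reals all_analysis.
Set Implicit Arguments. Unset Strict Implicit. Unset Printing Implicit Defensive.
Import Order.TTheory GRing.Theory Num.Theory.
Local Open Scope classical_set_scope.
Local Open Scope ring_scope.

(* R^d is represented as d.-tuple R, equipped with the library's product
   sigma-algebra (generated by the coordinate maps), i.e. the Borel sets. *)

Definition sup_dist (R : realType) (d : nat) (x y : d.-tuple R) : R :=
  \big[Num.max/0]_(i < d) `|tnth x i - tnth y i|.

Fixpoint tint (R : realType) (T : Type) (I : (T -> \bar R) -> \bar R) (n : nat)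
  : (n.-tuple T -> \bar R) -> \bar R :=
  match n return (n.-tuple T -> \bar R) -> \bar R with
  | 0 => fun F => F [tuple]
  | m.+1 => fun F => I (fun t => tint I (fun x : m.-tuple T => F [tuple of t :: x]))
  end.

(* Lebesgue integral over R^d of a nonnegative function (iterated, Tonelli). *)
Definition leb_int (R : realType) (d : nat) (g : d.-tuple R -> \bar R) : \bar R :=
  tint (fun h : R -> \bar R => (\int[@lebesgue_measure R]_t h t)%E) g.

Definition is_density (R : realType) (d : nat) (f : d.-tuple R -> R) : Prop :=
  measurable_fun [set: d.-tuple R] f /\ (forall x, 0 <= f x) /\
  leb_int (fun x => (f x)%:E) = 1%E.

(* compact support: the support {f <> 0} is bounded (hence its closure compact). *)
Definition has_compact_support (R : realType) (d : nat) (f : d.-tuple R -> R) : Prop :=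
  exists M : R, forall x, f x != 0 -> sup_dist x [tuple of nseq d 0] <= M.

Definition unique_mode (R : realType) (d : nat) (f : d.-tuple R -> R) (x0 : d.-tuple R) : Prop :=
  forall x, x != x0 -> f x < f x0.

(* P_f^{(x)n}(E) for a set E of samples (X_1,...,X_n), X_i in R^d:
   the iterated integral over (R^d)^n of 1_E(x) * prod_i f(x_i). *)
Definition prob_sample (R : realType) (d n : nat) (f : d.-tuple R -> R)
  (E : set (n.-tuple (d.-tuple R))) : \bar R :=
  tint (fun g : d.-tuple R -> \bar R => leb_int (fun x => ((f x)%:E * g x)%E))
       (fun s => (\1_E s)%:E).

(* Main.v *)
Require Import Defs.
From HB Require Import structures.
From mathcomp Require Import all_boot all_order all_algebra.
From mathcomp Require Import all_classical all_reals all_analysis.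
From mathcomp Require Import measurable_realfun ring lra.
Import Order.TTheory GRing.Theory Num.Theory.
Local Open Scope classical_set_scope.
Local Open Scope ring_scope.

(** With [r = n^(-1/(d+2 beta)) / 12] and modes [x1 = (r, ..., r)], [x2 = - x1],
    take [f_j] proportional to the function equal to [M - |x - x_j|^beta] on the
    ball of radius [r] around [x_j], to [M - (|x| + r)^beta] on the rest of the
    unit cube, and to [0] outside. The triangle inequality gives the two-sided
    bounds around the mode, and the two functions have the same integral because
    they are reflections of each other. They differ by at most [(3 r)^beta],
    and only on the cube of radius [2 r], so their chi-square divergence is
    at most [1 / (2 n)].
    For the product densities [p1], [p2], the pointwise inequality
    [p2 <= p1 + p2^2 / (4 p1)] bounds the sum of the two errors below by
    [1 - (1 + chi^2)^n / 4 >= 1 / 2]. *)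

(* Parametric measurability makes this class of functionals stable under the
   iteration [tint], so that the iterated integrals over [R^d] and [(R^d)^n]
   are handled without constructing product measures. *)
Record tonelli_functional {d : measure_display} {T : measurableType d}
    {R : realType} (I : (T -> \bar R) -> \bar R) : Prop := {
  tf_ge0 : forall F : T -> \bar R, (forall t, (0 <= F t)%E) -> (0 <= I F)%E ;
  tf_le : forall F G : T -> \bar R,
    (forall t, (0 <= F t)%E) -> measurable_fun [set: T] F ->
    measurable_fun [set: T] G -> (forall t, (F t <= G t)%E) ->
    (I F <= I G)%E ;
  tf_add : forall F G : T -> \bar R,
    (forall t, (0 <= F t)%E) -> measurable_fun [set: T] F ->
    (forall t, (0 <= G t)%E) -> measurable_fun [set: T] G ->
    (I (fun t => F t + G t) = I F + I G)%E ;
  tf_scale : forall (c : R) (F : T -> \bar R), 0 <= c ->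
    (forall t, (0 <= F t)%E) -> measurable_fun [set: T] F ->
    (I (fun t => c%:E * F t) = c%:E * I F)%E ;
  tf_measurable : forall (d' : measure_display) (S : measurableType d')
    (F : S * T -> \bar R),
    (forall p, (0 <= F p)%E) -> measurable_fun [set: S * T] F ->
    measurable_fun [set: S] (fun s => I (fun t => F (s, t))) }.

(** * Iteration of Tonelli functionals over tuples *)

Section tonelli_tint.
Context {d : measure_display} {T : measurableType d} {R : realType}.
Variable I : (T -> \bar R) -> \bar R.
Hypothesis HI : tonelli_functional I.

Lemma measurable_fun_section {d' : measure_display} {S : measurableType d'}
    {d'' : measure_display} {U : measurableType d''} (F : S * U -> \bar R) (s : S) :
  measurable_fun [set: S * U] F -> measurable_fun [set: U] (fun u => F (s, u)).
Proof. by move=> mF; apply: measurableT_comp mF _; exact: measurable_pair1. Qed.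

Lemma measurable_fun_cons_pair {d' : measure_display} {S : measurableType d'}
    (n : nat) (F : S * n.+1.-tuple T -> \bar R) :
  measurable_fun [set: S * n.+1.-tuple T] F ->
  measurable_fun [set: (S * T) * n.-tuple T]
    (fun p => F (p.1.1, [tuple of p.1.2 :: p.2])).
Proof.
move=> mF; apply: measurableT_comp mF _; apply: measurable_fun_pair.
  exact: measurableT_comp measurable_fst measurable_fst.
apply: measurable_cons => //.
exact: measurableT_comp measurable_snd measurable_fst.
Qed.

Lemma measurable_fun_cons (n : nat) (F : n.+1.-tuple T -> \bar R) :
  measurable_fun [set: n.+1.-tuple T] F ->
  measurable_fun [set: T * n.-tuple T] (fun p => F [tuple of p.1 :: p.2]).
Proof. by move=> mF; apply: measurableT_comp mF _; exact: measurable_cons. Qed.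

Lemma measurable_fun_cons1 (n : nat) (F : n.+1.-tuple T -> \bar R) (t : T) :
  measurable_fun [set: n.+1.-tuple T] F ->
  measurable_fun [set: n.-tuple T] (fun x => F [tuple of t :: x]).
Proof. by move=> /measurable_fun_cons /measurable_fun_section; exact. Qed.

(** By induction on [n]. Every clause for [I] asks that the inner iterated integral be measurable in
    the first coordinate. The parametric clause at [n], with that coordinate as parameter, provides
    this ([mtint]). *)
Lemma tonelli_tint (n : nat) : tonelli_functional (@tint R T I n).
Proof.
elim: n => [|n IH].
  split=> //= [d' S F F0 mF]; apply: measurableT_comp mF _.
  exact: measurable_fun_pair.
have mtint (F : n.+1.-tuple T -> \bar R) : (forall t, (0 <= F t)%E) ->
    measurable_fun setT F ->
    measurable_fun setT
      (fun t => tint I (fun x : n.-tuple T => F [tuple of t :: x])).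
  move=> F0 mF; apply: (tf_measurable _ IH _ _
    (fun p : T * n.-tuple T => F [tuple of p.1 :: p.2])) => //.
  exact: measurable_fun_cons.
split=> /=.
- by move=> F F0; apply: (tf_ge0 _ HI) => t; exact: (tf_ge0 _ IH).
- move=> F G F0 mF mG FG; apply: (tf_le _ HI).
  + by move=> t; exact: (tf_ge0 _ IH).
  + exact: mtint.
  + by apply: mtint => // t; exact: le_trans (F0 t) (FG t).
  + by move=> t; apply: (tf_le _ IH) => //; exact: measurable_fun_cons1.
- move=> F G F0 mF G0 mG; rewrite -(tf_add _ HI).
  + congr (I _); apply/funext => t.
    by rewrite (tf_add _ IH) //; exact: measurable_fun_cons1.
  + by move=> t; exact: (tf_ge0 _ IH).
  + exact: mtint.
  + by move=> t; exact: (tf_ge0 _ IH).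
  + exact: mtint.
- move=> c F c0 F0 mF; rewrite -(tf_scale _ HI) //.
  + congr (I _); apply/funext => t.
    by rewrite (tf_scale _ IH) //; exact: measurable_fun_cons1.
  + by move=> t; exact: (tf_ge0 _ IH).
  + exact: mtint.
(* The inner integral has to be jointly measurable in the parameter and the first coordinate, so the
   induction hypothesis is used with parameter space [S * T]. *)
- move=> d' S F F0 mF.
  apply: (tf_measurable _ HI _ _ (fun p => tint I
    (fun x : n.-tuple T => F (p.1, [tuple of p.2 :: x])))).
    by move=> p; exact: (tf_ge0 _ IH).
  apply: (tf_measurable _ IH _ _
    (fun p : (S * T) * n.-tuple T => F (p.1.1, [tuple of p.1.2 :: p.2]))) => //.
  exact: measurable_fun_cons_pair.
Qed.

Lemma measurable_fun_tprod (n : nat) (g : T -> R) :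
  measurable_fun [set: T] g ->
  measurable_fun [set: n.-tuple T] (fun x => \prod_(i < n) g (tnth x i)).
Proof.
move=> mg; apply: measurable_prod => i _.
exact: measurableT_comp mg (measurable_tnth i).
Qed.

Lemma tprod_cons (n : nat) (g : T -> R) (t : T) (x : n.-tuple T) :
  \prod_(i < n.+1) g (tnth [tuple of t :: x] i) =
  g t * \prod_(i < n) g (tnth x i).
Proof.
by rewrite big_ord_recl tnth0; congr (_ * _); apply: eq_bigr => i _; rewrite tnthS.
Qed.

(** The factor [g t] leaves the inner integral, which is [c ^+ n] by induction; this constant then
    leaves the outer one. *)
Lemma tint_tprod (n : nat) (g : T -> R) (c : R) : (forall t, 0 <= g t) ->
  measurable_fun [set: T] g -> I (EFin \o g) = c%:E ->
  tint I (fun x : n.-tuple T => (\prod_(i < n) g (tnth x i))%:E) = (c ^+ n)%:E.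
Proof.
move=> g0 mg Ig; have c0 : 0 <= c.
  by rewrite -lee_fin -Ig; apply: (tf_ge0 _ HI) => t; rewrite lee_fin g0.
elim: n => [|n IH] /=; first by rewrite big_ord0 expr0.
rewrite exprSr EFinM -Ig -(tf_scale _ HI) ?exprn_ge0 //.
- congr (I _); apply/funext => t /=.
  rewrite muleC -IH -(tf_scale _ (tonelli_tint n)) //.
  + by congr (tint I _); apply/funext => x; rewrite -EFinM tprod_cons.
  + by move=> x; rewrite lee_fin prodr_ge0.
  + by apply/measurable_EFinP; exact: measurable_fun_tprod.
- exact/measurable_EFinP.
Qed.

(** [prob_sample] has one density weight inside each nested integral. Gathering them into a product
    density puts both error probabilities under the same functional, where integrands can be
    compared pointwise. *)
Lemma tint_weighted (n : nat) (g : T -> R) (F : n.-tuple T -> \bar R) :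
  (forall t, 0 <= g t) -> measurable_fun [set: T] g ->
  (forall x, (0 <= F x)%E) -> measurable_fun [set: n.-tuple T] F ->
  tint (fun h => I (fun t => ((g t)%:E * h t)%E)) F =
  tint I (fun x => ((\prod_(i < n) g (tnth x i))%:E * F x)%E).
Proof.
move=> g0 mg; elim: n F => [|n IH] F F0 mF /=.
  by rewrite big_ord0 mul1e.
congr (I _); apply/funext => t; rewrite IH //; last exact: measurable_fun_cons1.
rewrite -(tf_scale _ (tonelli_tint n)) //.
- by congr (tint I _); apply/funext => x; rewrite tprod_cons muleA -EFinM.
- by move=> x; rewrite mule_ge0 ?lee_fin ?prodr_ge0.
- apply: emeasurable_funM; last exact: measurable_fun_cons1.
  by apply/measurable_EFinP; exact: measurable_fun_tprod.
Qed.

End tonelli_tint.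

(** * Lebesgue integration on R^d and its invariance under reflection *)

Lemma tonelli_lebesgue (R : realType) :
  tonelli_functional (fun h : R -> \bar R => (\int[@lebesgue_measure R]_t h t)%E).
Proof.
split.
- by move=> F F0; apply: integral_ge0.
- by move=> F G F0 mF mG FG; apply: ge0_le_integral.
- by move=> F G F0 mF G0 mG; rewrite ge0_integralD.
- by move=> c F c0 F0 mF; rewrite ge0_integralZl_EFin.
- by move=> d S F F0 mF; apply: measurable_fun_fubini_tonelli_F.
Qed.

Lemma tonelli_leb_int (R : realType) (d : nat) :
  tonelli_functional (@leb_int R d).
Proof. exact: (tonelli_tint _ (tonelli_lebesgue R)). Qed.

Lemma ge0_integralN (R : realType) (f : R -> \bar R) :
  measurable_fun [set: R] f -> (forall t, (0 <= f t)%E) ->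
  (\int[lebesgue_measure]_t f (- t)%R = \int[lebesgue_measure]_t f t)%E.
Proof.
move=> mf f0.
have -> : [set: R] = (-%R : _ -> measurableTypeR R) @^-1` [set: R] by [].
rewrite -ge0_integral_pushforward//=.
by apply: eq_measure_integral => //= A mA AS; exact: lebesgue_measureN.
Qed.

(** The coordinates are reflected one at a time, each by invariance of one-dimensional Lebesgue
    measure. This is what gives the two peaks a common normalising constant. *)
Lemma leb_intN (R : realType) (d : nat) (F : d.-tuple R -> \bar R) :
  measurable_fun [set: d.-tuple R] F -> (forall x, (0 <= F x)%E) ->
  leb_int (fun x => F (map_tuple -%R x)) = leb_int F.
Proof.
elim: d F => [|d IH] F mF F0; rewrite /leb_int /=.
  by congr F; exact: val_inj.
rewrite -[RHS]ge0_integralN; last 2 first.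
- apply: (tf_measurable _ (tonelli_leb_int R d) _ _
    (fun p : R * d.-tuple R => F [tuple of p.1 :: p.2])) => //.
  exact: measurable_fun_cons.
- by move=> t; exact: (tf_ge0 _ (tonelli_leb_int R d)).
congr (integral _ _ _); apply/funext => t.
have := IH (fun x => F [tuple of - t :: x]).
rewrite /leb_int => <- //; last exact: measurable_fun_cons1.
by congr tint; apply/funext => x; congr F; exact: val_inj.
Qed.

(** * The sup-distance and the volume of cubes *)

Lemma sup_dist_ge0 (R : realType) (d : nat) (x y : d.-tuple R) :
  0 <= sup_dist x y.
Proof. exact: bigmax_ge_id. Qed.

Lemma sup_dist_leP (R : realType) (d : nat) (x y : d.-tuple R) (e : R) :
  0 <= e ->
  reflect (forall i, `|tnth x i - tnth y i| <= e) (sup_dist x y <= e).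
Proof.
move=> e0; apply: (iffP (bigmax_leP _ _ _ _)) => [[_ H] i|H]; first exact: H.
by split.
Qed.

Lemma ler_sup_dist (R : realType) (d : nat) (x y : d.-tuple R) (i : 'I_d) :
  `|tnth x i - tnth y i| <= sup_dist x y.
Proof. by move: i; apply/sup_dist_leP => //; exact: sup_dist_ge0. Qed.

Lemma sup_distC (R : realType) (d : nat) (x y : d.-tuple R) :
  sup_dist x y = sup_dist y x.
Proof. by apply: eq_bigr => i _; exact: distrC. Qed.

Lemma sup_dist_triangle (R : realType) (d : nat) (y x z : d.-tuple R) :
  sup_dist x z <= sup_dist x y + sup_dist y z.
Proof.
apply/sup_dist_leP => [|i]; first by rewrite addr_ge0 ?sup_dist_ge0.
rewrite (le_trans (ler_distD (tnth y i) _ _))//.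
by rewrite lerD ?ler_sup_dist.
Qed.

Lemma sup_distxx (R : realType) (d : nat) (x : d.-tuple R) : sup_dist x x = 0.
Proof.
apply/eqP; rewrite eq_le sup_dist_ge0 andbT; apply/sup_dist_leP => // i.
by rewrite subrr normr0.
Qed.

Lemma sup_dist_gt0 (R : realType) (d : nat) (x y : d.-tuple R) :
  x != y -> 0 < sup_dist x y.
Proof.
apply: contraNT; rewrite -leNgt => /sup_dist_leP H; apply/eqP/eq_from_tnth => i.
by apply/eqP; rewrite -subr_eq0 -normr_le0; exact: H.
Qed.

Lemma sup_distN (R : realType) (d : nat) (x y : d.-tuple R) :
  sup_dist (map_tuple -%R x) (map_tuple -%R y) = sup_dist x y.
Proof.
by apply: eq_bigr => i _; rewrite !tnth_map -opprD normrN.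
Qed.

Lemma measurable_sup_dist (R : realType) (d : nat) (y : d.-tuple R) :
  measurable_fun [set: d.-tuple R] (fun x => sup_dist x y).
Proof.
rewrite /sup_dist; elim: (index_enum _) => [|i s IH].
  by under eq_fun do rewrite big_nil; exact: measurable_cst.
under eq_fun do rewrite big_cons.
apply: measurable_maxr => //; apply: measurableT_comp => //.
by apply: measurable_funB => //; exact: measurable_tnth.
Qed.

Notation origin R d := ([tuple of nseq d 0] : d.-tuple R).

(** A sup-norm ball is a product of intervals, so its indicator is the product of the indicators of
    [[-e, e]] at the coordinates and [tint_tprod] applies. *)
Lemma leb_int_cube (R : realType) (d : nat) (e : R) : 0 <= e ->
  leb_int (fun x : d.-tuple R => (if sup_dist x (origin R d) <= e then 1 else 0)%:E)
  = ((2 * e) ^+ d)%:E.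
Proof.
move=> e0; pose g : R -> R := \1_`[- e, e]%classic.
have <- : tint (fun h : R -> \bar R => (\int[lebesgue_measure]_t h t)%E)
   (fun x : d.-tuple R => (\prod_(i < d) g (tnth x i))%:E) = ((2 * e) ^+ d)%:E.
  apply: (tint_tprod _ (tonelli_lebesgue R)).
  - by move=> t; rewrite /g indicE.
  - exact: measurable_indic.
  rewrite /g (integral_indic _ measurableT) //= setIT lebesgue_measure_itv/= lte_fin.
  rewrite opprK; case: ltP => ee; congr EFin; lra.
congr tint; apply/funext => x; congr EFin.
have gE t : g t = if `|t| <= e then 1 else 0.
  rewrite /g indicE ler_norml; case: ifPn => te.
    by rewrite mem_set //= in_itv.
  by rewrite memNset //= in_itv /=; exact/negP.
case: sup_dist_leP => // [H|H].
  rewrite big1 // => i _; rewrite gE.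
  by have := H i; rewrite tnth_nseq subr0 => ->.
move/existsNP : H => [i Hi]; rewrite (bigD1 i) //= gE.
by move: Hi; rewrite tnth_nseq subr0 => /negP/negbTE ->; rewrite mul0r.
Qed.

(** * Chi-square divergence and the two-point lower bound *)

Lemma measurable_funV_ge0 {disp : measure_display} {T : measurableType disp}
    {R : realType} (f : T -> R) : (forall x, 0 <= f x) ->
  measurable_fun [set: T] f -> measurable_fun [set: T] (fun x => (f x)^-1).
Proof.
move=> f0 mf; have -> : (fun x => (f x)^-1) = (fun x => f x `^ (-1)).
  by apply/funext => x; rewrite powR_inv1.
exact: (measurableT_comp (measurable_powR _) mf).
Qed.

(** Expanding the square gives [f2^2 / f1 + f1 = 2 f2 + (f2 - f1)^2 / f1]. It is integrated in this
    form, with sums of nonnegative terms only, so that no subtraction of extended reals occurs. *)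
Lemma leb_int_sqr_div (R : realType) (d : nat) (f1 f2 : d.-tuple R -> R) (e : R) :
  is_density f1 -> is_density f2 -> (forall x, f1 x = 0 -> f2 x = 0) ->
  (leb_int (fun x => ((f2 x - f1 x) ^+ 2 / f1 x)%:E) <= e%:E)%E ->
  exists2 c : R, c <= 1 + e & leb_int (fun x => (f2 x ^+ 2 / f1 x)%:E) = c%:E.
Proof.
move=> [mf1 [f10 if1]] [mf2 [f20 if2]] f12 chi.
pose I := tonelli_leb_int R d.
set q := fun x => (f2 x ^+ 2 / f1 x)%:E.
set k := fun x => ((f2 x - f1 x) ^+ 2 / f1 x)%:E in chi *.
have mV := measurable_funV_ge0 _ f10 mf1.
have mq : measurable_fun setT q.
  apply/measurable_EFinP; apply: measurable_funM => //.
  exact: measurable_funX.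
have mk : measurable_fun setT k.
  apply/measurable_EFinP; apply: measurable_funM => //.
  by apply: measurable_funX; exact: measurable_funB.
have q0 x : (0 <= q x)%E by rewrite lee_fin divr_ge0 ?sqr_ge0.
have k0 x : (0 <= k x)%E by rewrite lee_fin divr_ge0 ?sqr_ge0.
have E : (leb_int q + 1 = 2 + leb_int k)%E.
  have -> : (2 : \bar R)%E = (2%:E * leb_int (fun x => (f2 x)%:E))%E.
    by rewrite if2 mule1.
  rewrite -if1 -(tf_add _ I) //; last exact/measurable_EFinP.
  rewrite -(tf_scale _ I) //; last exact/measurable_EFinP.
  rewrite -(tf_add _ I) //.
  + congr leb_int; apply/funext => x; rewrite /q /k -EFinM -!EFinD; congr EFin.
    (* Where [f1] vanishes so does [f2], and the convention [0^-1 = 0] makes both sides zero. *)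
    have [fx|fx] := eqVneq (f1 x) 0; first by rewrite f12 // fx invr0; ring.
    by field.
  + by move=> x; rewrite -EFinM lee_fin mulr_ge0.
  + by apply: emeasurable_funM => //; exact/measurable_EFinP.
(* The integral of [k] is finite, being at most [e]; [E] then forces the integral of [q] to be
   finite. *)
move: E chi (tf_ge0 _ I _ k0) (tf_ge0 _ I _ q0).
case: (leb_int k) => [k'| |] //=.
case: (leb_int q) => [q'| |] //= E; rewrite !lee_fin => ke _ _.
exists q' => //; move: E; rewrite -!EFinD => -[]; lra.
Qed.

(** With [t = 1 / (2 n)], [c (1 - t) <= 1 - t^2 <= 1], so [c ^+ n (1 - t) ^+ n <= 1], while
    Bernoulli's inequality gives [(1 - t) ^+ n >= 1 - n t = 1 / 2]. *)
Lemma expr_1DV2n_le2 (R : realType) (n : nat) (c : R) : (0 < n)%N -> 0 <= c ->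
  c <= 1 + (2 * n%:R)^-1 -> c ^+ n <= 2.
Proof.
move=> n0 c0 cn; set t : R := (2 * n%:R)^-1 in cn.
have nR : 0 < n%:R :> R by rewrite ltr0n.
have t0 : 0 < t by rewrite invr_gt0 mulr_gt0.
have nt : n%:R * t = 2^-1 by rewrite /t; field; rewrite gt_eqF.
have t1 : t <= 2^-1.
  by rewrite -nt; apply: ler_peMl; [exact: ltW|rewrite ler1n].
have bern m : 1 - m%:R * t <= (1 - t) ^+ m.
  elim: m => [|m IH]; first by rewrite expr0 mul0r subr0.
  rewrite exprS; apply: (@le_trans _ _ ((1 - t) * (1 - m%:R * t))).
    have : 0 <= m%:R * t * t by rewrite !mulr_ge0 // ltW.
    by rewrite -natr1; lra.
  by apply: ler_wpM2l => //; lra.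
have := bern n; rewrite nt => H.
have : c ^+ n * (1 - t) ^+ n <= 1.
  rewrite -exprMn; apply: exprn_ile1.
    by rewrite mulr_ge0 //; lra.
  apply: (@le_trans _ _ ((1 + t) * (1 - t))).
    by apply: ler_wpM2r => //; lra.
  by have := sqr_ge0 t; rewrite expr2; lra.
have cn0 : 0 <= c ^+ n by exact: exprn_ge0.
have : c ^+ n * 2^-1 <= c ^+ n * (1 - t) ^+ n.
  by apply: ler_wpM2l => //; lra.
lra.
Qed.

Lemma le_min_chi_square (R : realFieldType) (p q : R) : 0 < p ->
  q <= p + 4^-1 * (q ^+ 2 / p).
Proof.
move=> p0; rewrite -subr_ge0.
have -> : p + 4^-1 * (q ^+ 2 / p) - q = (p - q / 2) ^+ 2 / p.
  by field; rewrite gt_eqF.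
by rewrite divr_ge0 ?sqr_ge0 // ltW.
Qed.

Lemma two_point_lower_bound (R : realType) (d n : nat) (f1 f2 : d.-tuple R -> R)
    (psi : n.-tuple (d.-tuple R) -> nat) :
  is_density f1 -> is_density f2 -> (forall x, f1 x = 0 -> f2 x = 0) ->
  (leb_int (fun x => ((f2 x - f1 x) ^+ 2 / f1 x)%:E) <= ((2 * n%:R)^-1)%:E)%E ->
  (0 < n)%N ->
  measurable_fun [set: n.-tuple (d.-tuple R)] psi ->
  (forall s, psi s = 1%N \/ psi s = 2%N) ->
  ((1 / 5)%:E <= maxe (prob_sample f1 [set s | psi s <> 1%N])
                      (prob_sample f2 [set s | psi s <> 2%N]))%E.
Proof.
move=> D1 D2 f12 chi n0 mpsi psi12.
have [c c1 qc] := leb_int_sqr_div _ _ _ _ _ D1 D2 f12 chi.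
move: D1 D2 => [mf1 [f10 if1]] [mf2 [f20 if2]].
pose L := tonelli_leb_int R d.
pose J := tonelli_tint _ L n.
have q0 x : 0 <= f2 x ^+ 2 / f1 x by rewrite divr_ge0 ?sqr_ge0.
have c0 : 0 <= c.
  by rewrite -lee_fin -qc; apply: (tf_ge0 _ L) => x; rewrite lee_fin.
have mq : measurable_fun setT (fun x => f2 x ^+ 2 / f1 x).
  apply: measurable_funM; first exact: measurable_funX.
  exact: measurable_funV_ge0.
have mE k : measurable [set s | psi s <> k].
  by rewrite -[X in measurable X]setTI; exact: (mpsi measurableT (~` [set k])).
pose p1 (s : n.-tuple (d.-tuple R)) := \prod_(i < n) f1 (tnth s i).
pose p2 (s : n.-tuple (d.-tuple R)) := \prod_(i < n) f2 (tnth s i).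
pose pq (s : n.-tuple (d.-tuple R)) := \prod_(i < n) (f2 (tnth s i) ^+ 2 / f1 (tnth s i)).
have p10 s : 0 <= p1 s by apply: prodr_ge0.
have p20 s : 0 <= p2 s by apply: prodr_ge0.
have pq0 s : 0 <= pq s by apply: prodr_ge0.
have mp1 : measurable_fun setT p1 by exact: measurable_fun_tprod.
have mp2 : measurable_fun setT p2 by exact: measurable_fun_tprod.
have mpq : measurable_fun setT pq.
  exact: (measurable_fun_tprod _ (fun x => f2 x ^+ 2 / f1 x)).
rewrite /prob_sample !(tint_weighted _ L) //; last 2 first.
- by apply/measurable_EFinP; exact: measurable_indic.
- by apply/measurable_EFinP; exact: measurable_indic.
set F1 := fun s => _; set F2 := (X in maxe _ (tint _ X)).
have mF1 : measurable_fun setT F1.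
  by apply: emeasurable_funM; apply/measurable_EFinP => //; exact: measurable_indic.
have mF2 : measurable_fun setT F2.
  by apply: emeasurable_funM; apply/measurable_EFinP => //; exact: measurable_indic.
have F10 s : (0 <= F1 s)%E.
  by apply: mule_ge0; rewrite lee_fin ?indicE //; exact: p10.
have F20 s : (0 <= F2 s)%E.
  by apply: mule_ge0; rewrite lee_fin ?indicE //; exact: p20.
(* The pointwise form is [p2 <= F1 + F2 + pq / 4]. Where [psi = 1], [F2] equals [p2]; where
   [psi = 2], [F1] equals [p1] and [le_min_chi_square] applies. By [tint_tprod], [p2] integrates to
   [1] and [pq] to [c ^+ n]. *)
have key : (1 <= tint (@leb_int R d) F1 + tint (@leb_int R d) F2
               + (4^-1 * c ^+ n)%:E)%E.
  have -> : (1%E : \bar R) = tint (@leb_int R d) (fun s => (p2 s)%:E).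
    by rewrite (tint_tprod _ L _ _ 1) // expr1n.
  rewrite EFinM -(tint_tprod _ L _ _ _ q0 mq qc) -(tf_scale _ J) //; last exact/measurable_EFinP.
  have mS : measurable_fun setT (fun s => (4^-1)%:E * (pq s)%:E)%E.
    by apply: emeasurable_funM => //; exact/measurable_EFinP.
  have S0 s : (0 <= (4^-1)%:E * (pq s)%:E)%E.
    by rewrite -EFinM lee_fin mulr_ge0 ?invr_ge0.
  rewrite -(tf_add _ J) // -(tf_add _ J) //.
  - apply: (tf_le _ J) => //.
    + exact/measurable_EFinP.
    + by apply: emeasurable_funD => //; exact: emeasurable_funD.
    move=> s; rewrite /F1 /F2 -/(p1 s) -/(p2 s) -/(pq s) -!EFinM -!EFinD lee_fin.
    have pqE : pq s = p2 s ^+ 2 / p1 s.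
      by rewrite /pq prodf_div prodrXl.
    have [s1|s2] := psi12 s.
      rewrite [X in _ * X + _]indicE memNset /=; last by rewrite s1.
      rewrite indicE mem_set /=; last by rewrite s1.
      have := pq0 s; lra.
    rewrite indicE mem_set /=; last by rewrite s2.
    rewrite [X in _ + _ * X + _]indicE memNset /=; last by rewrite s2; exact.
    rewrite mulr1 mulr0 addr0 pqE.
    (* If [p1 s = 0], some factor [f1 (tnth s i)] vanishes, hence so does the matching factor of
       [p2 s]. *)
    have [ps|ps] := eqVneq (p1 s) 0; last by rewrite le_min_chi_square // lt0r ps p10.
    move/eqP: (ps); rewrite prodf_seq_eq0 => /hasP[i _ /= /eqP fi].
    have -> : p2 s = 0 by rewrite /p2 (bigD1 i) //= f12 // mul0r.
    by rewrite ps; lra.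
  - by move=> s; rewrite adde_ge0.
  - exact: emeasurable_funD.
have c2 : c ^+ n <= 2 by exact: expr_1DV2n_le2.
(* Two errors below [1 / 5] would sum to less than [2 / 5], against the lower bound [1 - 2 / 4]. *)
rewrite leNgt; apply/negP; rewrite gt_max => /andP[H1 H2].
move: key H1 H2 (tf_ge0 _ J _ F10) (tf_ge0 _ J _ F20).
case: (tint _ F1) => [a| |] //; case: (tint _ F2) => [b| |] //.
by rewrite -!EFinD !lee_fin !lte_fin; lra.
Qed.

(** * The unnormalised peak functions *)

Section peak.
Context {R : realType} {d : nat}.
Variables (beta r : R).
Hypotheses (beta0 : 0 < beta) (r0 : 0 < r) (r12 : r <= 12^-1).

(** Inside the unit cube every base raised to [beta] in [peak] is at most [1 + r <= 2], so this
    height keeps the function at least [1] there. *)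
Definition peak_height : R := 2 `^ beta + 1.

Local Notation M := peak_height.
Local Notation norm x := (sup_dist x (origin R d)).

(** Away from the small ball the value does not depend on [x0], so two peaks differ only near their
    modes. There [norm x + r] dominates the distance to [x0], which keeps [x0] the maximiser. *)
Definition peak (x0 x : d.-tuple R) : R :=
  if sup_dist x x0 < r then M - sup_dist x x0 `^ beta
  else if norm x <= 1 then M - (norm x + r) `^ beta else 0.

Let powR_le (x y : R) : 0 <= x -> x <= y -> x `^ beta <= y `^ beta.
Proof.
move=> x0 xy; apply: ge0_ler_powR; rewrite ?nnegrE //; first exact: ltW.
exact: le_trans xy.
Qed.

Lemma peak_height_ge1 : 1 < M.
Proof. by rewrite ltrDr powR_gt0. Qed.

Variable x0 : d.-tuple R.
Hypothesis x0r : norm x0 <= r.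

Let norm_le x : norm x <= sup_dist x x0 + r.
Proof. by rewrite (le_trans (sup_dist_triangle _ _ x0 _ _)) // lerD2l. Qed.

Let dist_le x : sup_dist x x0 <= norm x + r.
Proof.
rewrite (le_trans (sup_dist_triangle _ _ (origin R d) _ _)) // lerD2l.
by rewrite sup_distC.
Qed.

Lemma measurable_peak : measurable_fun [set: d.-tuple R] (peak x0).
Proof.
have mpow (g : d.-tuple R -> R) : measurable_fun setT g ->
    measurable_fun setT (fun x => M - g x `^ beta).
  move=> mg; apply: measurable_funB => //.
  exact: (measurableT_comp (measurable_powR _) mg).
apply: measurable_fun_ifT.
- by apply: measurable_fun_ltr => //; exact: measurable_sup_dist.
- by apply: mpow; exact: measurable_sup_dist.
apply: measurable_fun_ifT => //.
- by apply: measurable_fun_ler => //; exact: measurable_sup_dist.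
apply: mpow; apply: measurable_funD => //; exact: measurable_sup_dist.
Qed.

(** The ball of radius [r] around [x0] lies in the cube of radius [2 r < 1], so the first branch
    cannot apply. *)
Lemma peak_out (x : d.-tuple R) : 1 < norm x -> peak x0 x = 0.
Proof.
move=> x1; rewrite /peak (leNgt _ 1) x1 /= ifF //.
by apply/negbTE; rewrite -leNgt; have := norm_le x; have := r12; lra.
Qed.

Lemma peak_ge1 (x : d.-tuple R) : norm x <= 1 -> 1 <= peak x0 x.
Proof.
move=> x1; rewrite /peak x1 /M; have := r12.
case: ifPn => xr r12'; rewrite addrAC lerDr subr_ge0; apply: powR_le.
- exact: sup_dist_ge0.
- by lra.
- by rewrite addr_ge0 ?sup_dist_ge0 // ltW.
- by lra.
Qed.

Lemma peak_ge0 (x : d.-tuple R) : 0 <= peak x0 x.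
Proof.
case: (leP (norm x) 1) => x1; first by have := peak_ge1 _ x1; lra.
by rewrite peak_out.
Qed.

Lemma peak_mode : peak x0 x0 = M.
Proof. by rewrite /peak sup_distxx r0 powR0 ?subr0 // gt_eqF. Qed.

Lemma peak_upper (x : d.-tuple R) : norm x <= 1 ->
  peak x0 x <= M - sup_dist x x0 `^ beta.
Proof.
move=> x1; rewrite /peak x1; case: ifPn => // _.
by rewrite lerD2l lerN2 powR_le // sup_dist_ge0.
Qed.

Lemma peak_lower (x : d.-tuple R) : sup_dist x x0 <= 2^-1 ->
  M - 3 `^ beta * sup_dist x x0 `^ beta <= peak x0 x.
Proof.
move=> x2; have r12' := r12; have xn := norm_le x.
have s0 := sup_dist_ge0 _ _ x x0.
rewrite -powRM // /peak; case: ifPn => xr.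
  by rewrite lerD2l lerN2 powR_le //; lra.
rewrite ifT; last by lra.
rewrite -leNgt in xr.
rewrite lerD2l lerN2 powR_le //; last by lra.
by rewrite addr_ge0 ?sup_dist_ge0 // ltW.
Qed.

Lemma peak_far (x : d.-tuple R) : 2^-1 <= sup_dist x x0 ->
  peak x0 x <= M - 2^-1 `^ beta.
Proof.
move=> x2; case: (leP (norm x) 1) => x1.
  apply: (le_trans (peak_upper _ x1)).
  by rewrite lerD2l lerN2 powR_le.
rewrite peak_out // subr_ge0.
apply: (@le_trans _ _ (2 `^ beta)); first by apply: powR_le; lra.
by rewrite lerDl.
Qed.

Lemma peak_unique_mode : unique_mode (peak x0) x0.
Proof.
move=> x xx0; rewrite peak_mode; have s0 := sup_dist_gt0 _ _ _ _ xx0.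
case: (leP (norm x) 1) => x1.
  apply: (le_lt_trans (peak_upper _ x1)).
  by rewrite ltrBlDr ltrDl powR_gt0.
by rewrite peak_out //; have := peak_height_ge1; lra.
Qed.

Lemma peak_le_height (x : d.-tuple R) : peak x0 x <= M.
Proof.
have [->|xx0] := eqVneq x x0; first by rewrite peak_mode.
by have /ltW := peak_unique_mode _ xx0; rewrite peak_mode.
Qed.

(** The peak lies between the indicator of the unit cube and [M] times it. The bounds do not involve
    [r], so the shape constants will not depend on the sample size. *)
Lemma leb_int_peak : exists2 Z : R,
  2 ^+ d <= Z <= M * 2 ^+ d & leb_int (fun x => (peak x0 x)%:E) = Z%:E.
Proof.
pose L := tonelli_leb_int R d.
have mb : measurable_fun setT (fun x => (peak x0 x)%:E).
  by apply/measurable_EFinP; exact: measurable_peak.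
pose k x : R := if norm x <= 1 then 1 else 0.
have mk : measurable_fun setT (fun x => (k x)%:E).
  apply/measurable_EFinP; apply: measurable_fun_ifT => //.
  by apply: measurable_fun_ler => //; exact: measurable_sup_dist.
have k0 x : (0 <= (k x)%:E)%E by rewrite lee_fin /k; case: ifP.
have kI : leb_int (fun x => (k x)%:E) = (2 ^+ d)%:E.
  by rewrite leb_int_cube // mulr1.
have M1 := peak_height_ge1.
have lo : ((2 ^+ d)%:E <= leb_int (fun x => (peak x0 x)%:E))%E.
  rewrite -kI; apply: (tf_le _ L) => // x; rewrite lee_fin /k; case: ifPn => x1.
    exact: peak_ge1.
  exact: peak_ge0.
have hi : (leb_int (fun x => (peak x0 x)%:E) <= (M * 2 ^+ d)%:E)%E.
  rewrite EFinM -kI -(tf_scale _ L) //; last by lra.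
  apply: (tf_le _ L) => //.
  - by move=> x; rewrite lee_fin peak_ge0.
  - exact: emeasurable_funM.
  move=> x; rewrite -EFinM lee_fin /k; case: ifPn => x1.
    by rewrite mulr1 peak_le_height.
  by rewrite mulr0 peak_out // ltNge.
case: (leb_int _) lo hi => [Z| |] //; rewrite !lee_fin => lo hi.
by exists Z => //; rewrite lo hi.
Qed.

End peak.

(** * Comparison of two peaks and calibration of the radius *)

Lemma peakN (R : realType) (d : nat) (beta r : R) (x0 x : d.-tuple R) :
  peak beta r (map_tuple -%R x0) (map_tuple -%R x) = peak beta r x0 x.
Proof.
have o : origin R d = map_tuple -%R (origin R d).
  by apply: eq_from_tnth => i; rewrite tnth_map !tnth_nseq oppr0.
by rewrite /peak sup_distN {1 2}o !sup_distN.
Qed.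

(** Within the cube of radius [2 r] both values lie in [[M - (3 r)^beta, M]] and the denominator is
    at least [1]; beyond it both peaks take the branch that ignores the mode. *)
Lemma peak_sqr_diff (R : realType) (d : nat) (beta r : R) (a b x : d.-tuple R) :
  0 < beta -> 0 < r -> r <= 12^-1 ->
  sup_dist a (origin R d) <= r -> sup_dist b (origin R d) <= r ->
  (peak beta r b x - peak beta r a x) ^+ 2 / peak beta r a x <=
  (3 * r) `^ (2 * beta) * (if sup_dist x (origin R d) <= 2 * r then 1 else 0).
Proof.
move=> beta0 r0 r12 ar br.
case: (leP (sup_dist x (origin R d)) (2 * r)) => x2; last first.
  suff E c : sup_dist c (origin R d) <= r -> peak beta r c x =
      if sup_dist x (origin R d) <= 1
      then peak_height beta - (sup_dist x (origin R d) + r) `^ beta else 0.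
    by rewrite !E // subrr expr0n mul0r mulr0.
  move=> cr; rewrite /peak ifF //; apply/negbTE; rewrite -leNgt.
  by have := sup_dist_triangle _ _ c x (origin R d); lra.
rewrite mulr1.
have x1 : sup_dist x (origin R d) <= 1 by lra.
have ge1 : 1 <= peak beta r a x by exact: peak_ge1.
have rng c : sup_dist c (origin R d) <= r ->
    peak_height beta - (3 * r) `^ beta <= peak beta r c x <= peak_height beta.
  move=> cr; rewrite peak_le_height // andbT /peak x1.
  case: ifPn => xr; rewrite lerD2l lerN2; apply: ge0_ler_powR;
    rewrite ?nnegrE ?addr_ge0 ?sup_dist_ge0 //; lra.
have /andP[a1 a2] := rng _ ar.
have /andP[b1 b2] := rng _ br.
have p0 : 0 <= (3 * r) `^ beta by exact: powR_ge0.
apply: (@le_trans _ _ ((peak beta r b x - peak beta r a x) ^+ 2)).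
  by rewrite ler_pdivrMr ?ler_peMr ?sqr_ge0 //; lra.
rewrite (mulrC 2 beta) powRrM powR_mulrn //.
by rewrite -subr_ge0 subr_sqr mulr_ge0; lra.
Qed.

Lemma separation_power (R : realType) (d n : nat) (beta : R) :
  (0 < d)%N -> (0 < n)%N -> 0 < beta ->
  let r := n%:R `^ (- (d%:R + 2 * beta)^-1) / 12 in
  [/\ 0 < r, r <= 12^-1 & (3 * r) `^ (2 * beta) * (2 * r) ^+ d <= (2 * n%:R)^-1].
Proof.
move=> d0 n0 beta0 r.
set kappa := d%:R + 2 * beta in r *.
have nR : 0 < n%:R :> R by rewrite ltr0n.
have d1 : 1 <= d%:R :> R by rewrite ler1n.
have k1 : 1 <= kappa by rewrite /kappa; lra.
set u := n%:R `^ (- kappa^-1) in r *.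
have u0 : 0 < u by exact: powR_gt0.
have u1 : u <= 1.
  rewrite -(powRr0 n%:R); apply: ler_powR; first by rewrite ler1n.
  by rewrite oppr_le0 invr_ge0; lra.
have uk : u `^ kappa = n%:R^-1.
  rewrite /u -powRrM mulNr mulVf ?gt_eqF //; last by lra.
  by rewrite powR_inv1 // ltW.
have r0 : 0 < r by rewrite /r divr_gt0.
split => //; first by rewrite /r ler_pdivrMr // mulVf.
apply: (@le_trans _ _ ((3 * r) `^ kappa)).
  rewrite /kappa addrC powRD; last by apply/implyP => _; rewrite gt_eqF // mulr_gt0.
  rewrite powR_mulrn; last by lra.
  apply: ler_wpM2l; first exact: powR_ge0.
  by apply: lerXn2r; rewrite ?nnegrE; lra.
have -> : 3 * r = u * 4^-1 by rewrite /r; field.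
rewrite powRM ?invr_ge0 //; last exact: ltW.
rewrite uk invfM mulrC; apply: ler_wpM2r; first by rewrite invr_ge0 ltW.
apply: (@le_trans _ _ (4^-1 `^ 1)); last by rewrite powRr1; lra.
by apply: ger_powR => //; apply/andP; split; lra.
Qed.

(** Normalisation leaves a single factor [1 / Z], and the cube of radius [2 r] has volume
    [2^d (2 r)^d]; the factor [2^d] is absorbed by [Z]. *)
Lemma leb_int_peak_chi_square (R : realType) (d : nat) (beta r Z : R)
    (a b : d.-tuple R) :
  0 < beta -> 0 < r -> r <= 12^-1 -> 2 ^+ d <= Z ->
  sup_dist a (origin R d) <= r -> sup_dist b (origin R d) <= r ->
  (leb_int (fun x => ((peak beta r b x / Z - peak beta r a x / Z) ^+ 2 /
                      (peak beta r a x / Z))%:E)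
   <= ((3 * r) `^ (2 * beta) * (2 * r) ^+ d)%:E)%E.
Proof.
move=> beta0 r0 r12 Zd ar br.
have L := tonelli_leb_int R d.
have Z0 : 0 < Z by apply: lt_le_trans Zd; rewrite exprn_gt0.
pose C := (3 * r) `^ (2 * beta) / Z.
have C0 : 0 <= C by rewrite divr_ge0 ?powR_ge0 // ltW.
pose k (x : d.-tuple R) : R := if sup_dist x (origin R d) <= 2 * r then 1 else 0.
have mk : measurable_fun setT (fun x => (k x)%:E).
  apply/measurable_EFinP; apply: measurable_fun_ifT => //.
  by apply: measurable_fun_ler => //; exact: measurable_sup_dist.
have k0 x : (0 <= (k x)%:E)%E by rewrite lee_fin /k; case: ifP.
apply: (@le_trans _ _ (leb_int (fun x => C%:E * (k x)%:E)%E)).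
  apply: (tf_le _ L).
  - move=> x; rewrite lee_fin divr_ge0 ?sqr_ge0 // divr_ge0 ?peak_ge0 //.
    exact: ltW.
  - have mb c : measurable_fun setT (fun x => peak beta r c x / Z).
      by apply: measurable_funM => //; exact: measurable_peak.
    apply/measurable_EFinP; apply: measurable_funM.
      by apply: measurable_funX; apply: measurable_funB; exact: mb.
    apply: measurable_funV_ge0 => [x|]; last exact: mb.
    by rewrite divr_ge0 ?peak_ge0 // ltW.
  - exact: emeasurable_funM.
  move=> x; rewrite -EFinM lee_fin.
  have -> : (peak beta r b x / Z - peak beta r a x / Z) ^+ 2 / (peak beta r a x / Z)
      = (peak beta r b x - peak beta r a x) ^+ 2 / peak beta r a x / Z.
    have ZZ : Z^-1 ^+ 2 * Z = Z^-1 by field; rewrite gt_eqF.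
    by rewrite -mulrBl exprMn invfM invrK -[in RHS]ZZ; ring.
  rewrite /C [leRHS]mulrAC; apply: ler_wpM2r; first by rewrite invr_ge0 ltW.
  exact: peak_sqr_diff.
rewrite (tf_scale _ L) // leb_int_cube; last by lra.
rewrite -EFinM lee_fin /C -mulrA; apply: ler_wpM2l; first exact: powR_ge0.
rewrite mulrC ler_pdivrMr // exprMn [leRHS]mulrC.
by apply: ler_wpM2r => //; rewrite exprn_ge0 //; lra.
Qed.

Lemma is_density_peak (R : realType) (d : nat) (beta r Z : R) (x0 : d.-tuple R) :
  0 < beta -> 0 < r -> r <= 12^-1 -> sup_dist x0 (origin R d) <= r -> 0 < Z ->
  leb_int (fun x => (peak beta r x0 x)%:E) = Z%:E ->
  is_density (fun x => peak beta r x0 x / Z).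
Proof.
move=> beta0 r0 r12 x0r Z0 IZ; split; last split.
- by apply: measurable_funM => //; exact: measurable_peak.
- by move=> x; rewrite divr_ge0 ?peak_ge0 // ltW.
under [X in leb_int X]eq_fun do rewrite mulrC EFinM.
rewrite (tf_scale _ (tonelli_leb_int R d)) ?IZ.
- by rewrite -EFinM mulVf // gt_eqF.
- by rewrite invr_ge0 ltW.
- by move=> x; rewrite lee_fin peak_ge0.
- by apply/measurable_EFinP; exact: measurable_peak.
Qed.

(** * Choice of the constants and conclusion *)

Theorem theorem2 (R : realType) (d : nat) (beta : R) :
  (1 <= d)%N -> 0 < beta ->
  exists c0 C0 h0 A : R,
    [/\ 0 < c0, c0 < C0, 0 < h0 & 0 < A] /\
    forall n : nat, (0 < n)%N ->
    exists (f1 f2 : d.-tuple R -> R) (x1 x2 : d.-tuple R),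
      [/\ is_density f1, is_density f2,
          has_compact_support f1 & has_compact_support f2] /\
      unique_mode f1 x1 /\ unique_mode f2 x2 /\
          [/\ (forall f x0, (f, x0) = (f1, x1) \/ (f, x0) = (f2, x2) ->
                 (forall x, sup_dist x x0 <= h0 ->
                    f x0 - C0 * sup_dist x x0 `^ beta <= f x /\
                    f x <= f x0 - c0 * sup_dist x x0 `^ beta) /\
                 (forall x, h0 <= sup_dist x x0 -> f x <= f x0 - c0 * h0 `^ beta)),
              sup_dist x1 x2 >= (n%:R `^ (- (d%:R + 2 * beta)^-1)) / A &
              forall psi : n.-tuple (d.-tuple R) -> nat,
                measurable_fun [set: n.-tuple (d.-tuple R)] psi ->
                (forall s, psi s = 1%N \/ psi s = 2%N) ->
                (maxe (prob_sample f1 [set s | psi s <> 1%N])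
                      (prob_sample f2 [set s | psi s <> 2%N]) >= (1 / 5)%:E)%E].
Proof.
move=> d0 beta0.
set M : R := peak_height beta.
have M1 : 1 < M := peak_height_ge1 beta.
have D0 : 0 < 2 ^+ d :> R by rewrite exprn_gt0.
have p3 : 1 <= 3 `^ beta :> R.
  have : 3 `^ 0 <= 3 `^ beta :> R by apply: ler_powR; [lra|exact: ltW].
  by rewrite powRr0.
exists (M * 2 ^+ d)^-1, (3 `^ beta / 2 ^+ d), 2^-1, 6; split.
  split; rewrite ?invr_gt0 ?mulr_gt0 //; first by lra.
  rewrite invfM ltr_pM2r ?invr_gt0 //.
  by apply: lt_le_trans p3; rewrite invf_lt1 //; lra.
move=> n n0.
have [r0 r12 pow] := separation_power _ _ _ _ d0 n0 beta0.
set r := _ / 12 in r0 r12 pow.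
pose x1 : d.-tuple R := [tuple of nseq d r].
pose x2 : d.-tuple R := map_tuple -%R x1.
have x1r : sup_dist x1 (origin R d) <= r.
  apply/sup_dist_leP => [|i]; first exact: ltW.
  by rewrite !tnth_nseq subr0 gtr0_norm.
have x2r : sup_dist x2 (origin R d) <= r.
  apply/sup_dist_leP => [|i]; first exact: ltW.
  by rewrite tnth_map !tnth_nseq subr0 normrN gtr0_norm.
have [Z /andP[Zlo Zhi] Z1] := leb_int_peak _ _ beta0 r0 r12 _ x1r.
have Z2 : leb_int (fun x => (peak beta r x2 x)%:E) = Z%:E.
  rewrite -leb_intN ?Z1; last 2 first.
  - by apply/measurable_EFinP; exact: measurable_peak.
  - by move=> x; rewrite lee_fin peak_ge0.
  by rewrite -Z1; congr leb_int; apply/funext => x; rewrite peakN.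
have Z0 : 0 < Z by exact: lt_le_trans Zlo.
have supp x0 : sup_dist x0 (origin R d) <= r ->
    has_compact_support (fun x => peak beta r x0 x / Z).
  move=> x0r; exists 1 => x; apply: contraNT; rewrite -ltNge => xl.
  by rewrite peak_out // mul0r.
have mode x0 : sup_dist x0 (origin R d) <= r ->
    unique_mode (fun x => peak beta r x0 x / Z) x0.
  move=> x0r x xx0; rewrite ltr_pM2r ?invr_gt0 //.
  exact: peak_unique_mode.
have shape x0 : sup_dist x0 (origin R d) <= r ->
   let f x := peak beta r x0 x / Z in
   (forall x, sup_dist x x0 <= 2^-1 ->
      f x0 - 3 `^ beta / 2 ^+ d * sup_dist x x0 `^ beta <= f x /\
      f x <= f x0 - (M * 2 ^+ d)^-1 * sup_dist x x0 `^ beta) /\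
   (forall x, 2^-1 <= sup_dist x x0 -> f x <= f x0 - (M * 2 ^+ d)^-1 * 2^-1 `^ beta).
  move=> x0r f.
  have Zinv (t : R) : 0 <= t -> (M * 2 ^+ d)^-1 * t <= t / Z <= t / 2 ^+ d.
    move=> t0; rewrite mulrC !ler_wpM2l // lef_pV2 ?posrE //.
    by apply: mulr_gt0 => //; lra.
  split => [x xh|x xh].
    (* The triangle inequality bounds the norm by [1 / 2 + r]. *)
    have x1' : sup_dist x (origin R d) <= 1.
      by have := sup_dist_triangle _ _ x0 x (origin R d); lra.
    have s0 : 0 <= sup_dist x x0 `^ beta := powR_ge0 _ _.
    have t0 : 0 <= 3 `^ beta * sup_dist x x0 `^ beta by rewrite mulr_ge0 ?powR_ge0.
    have /andP[s1 _] := Zinv _ s0; have /andP[_ t1] := Zinv _ t0.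
    rewrite /f peak_mode //; split.
      apply: (@le_trans _ _ ((M - 3 `^ beta * sup_dist x x0 `^ beta) / Z)).
        by rewrite mulrBl lerD2l lerN2 [leRHS]mulrAC.
      by rewrite ler_pM2r ?invr_gt0 // peak_lower.
    apply: (@le_trans _ _ ((M - sup_dist x x0 `^ beta) / Z)).
      by rewrite ler_pM2r ?invr_gt0 // peak_upper.
    by rewrite mulrBl lerD2l lerN2.
  have /andP[s1 _] := Zinv _ (powR_ge0 2^-1 beta).
  rewrite /f peak_mode //.
  apply: (@le_trans _ _ ((M - 2^-1 `^ beta) / Z)).
    by rewrite ler_pM2r ?invr_gt0 // peak_far.
  by rewrite mulrBl lerD2l lerN2.
have D1 := is_density_peak _ _ _ _ _ _ beta0 r0 r12 x1r Z0 Z1.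
have D2 := is_density_peak _ _ _ _ _ _ beta0 r0 r12 x2r Z0 Z2.
exists (fun x => peak beta r x1 x / Z), (fun x => peak beta r x2 x / Z), x1, x2.
split; first by split => //; exact: supp.
split; first exact: mode.
split; first exact: mode.
split.
- by move=> f x0 [] [-> ->]; exact: shape.
(* The first coordinate, which exists because [d >= 1], already separates the modes by
   [r - (- r)]. *)
- apply: le_trans (ler_sup_dist _ _ _ _ (Ordinal d0)).
  rewrite tnth_map tnth_nseq opprK ger0_norm; last by lra.
  by rewrite /r; lra.
move=> psi mpsi psi12; apply: two_point_lower_bound => //.
  (* The first peak is at least [1] on the unit cube, so a zero of it lies outside, where the second
     peak vanishes as well. *)
  move=> x /eqP; rewrite mulf_eq0 invr_eq0 (gt_eqF Z0) orbF => /eqP bx.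
  rewrite peak_out ?mul0r // ltNge; apply/negP => xl.
  have : 1 <= peak beta r x1 x by exact: peak_ge1.
  by rewrite bx; lra.
apply: (@le_trans _ _ ((3 * r) `^ (2 * beta) * (2 * r) ^+ d)%:E).
  exact: leb_int_peak_chi_square.
by rewrite lee_fin.
Qed.
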